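(* Let $((Y_n,\Sigma_{Y_n},\mathcal{B}_n),f_{m,n},\mu_n)_{m,n\in\mathbb{N}}$ be a projective sequence of CPSs such that each $Y_n$ is a Souslin space. Then the CPS projective limit $((Y,\Sigma_Y,\mathcal{B}_Y),\overline{f}_n,\mu)_{n\in\mathbb{N}}$ exists, and $\mu$ is the unique limit CPS; that is, with $Y=\varprojlim Y_n$, $\overline{f}_n:Y\to Y_n$ the restricted coordinate projections and $\mathcal{B}_Y:=\overline{f}_1^{-1}(\mathcal{B}_1)$, there exists a unique CPS $\mu$ on $(Y,\Sigma_Y,\mathcal{B}_Y)$ such that $\overline{\mathcal{L}}_{\overline{f}_n}(\mu)=\mu_n$ for all $n\in\mathbb{N}$.
   Context: All topological spaces are metrizable; $\Sigma_X$ is the Borel $\sigma$-algebra. A Souslin space is a continuous image of a complete separable metric space. A family of conditioning events is a non-empty family of Borel sets not containing $\emptyset$. A CPS on $(X,\Sigma_X,\mathcal{B})$ is an array $\mu=(\mu(\cdot|B))_{B\in\mathcal{B}}$ of Borel probability measures with $\mu(B|B)=1$ and $\mu(A|B)\mu(B|C)=\mu(A|C)$ for $A\in\Sigma_X$, $B,C\in\mathcal{B}$, $A\subseteq B\subseteq C$. For measurable $f:X\to Y$ with $f^{-1}(\mathcal{B}_Y):=\{f^{-1}(B):B\in\mathcal{B}_Y\}=\mathcal{B}_X$, $\overline{\mathcal{L}}_f(\mu)(E|B):=\mu(f^{-1}(E)|f^{-1}(B))$. A projective sequence $(Y_n,f_{m,n})_{m,n\in\mathbb{N}}$: each $Y_n$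 a non-empty topological space, $f_{m,n}:Y_n\to Y_m$ continuous for $m\le n$, $f_{m,p}=f_{m,n}\circ f_{n,p}$ for $m\le n\le p$, $f_{n,n}=\mathrm{Id}$. Its projective limit is $\varprojlim Y_n:=\{(y_n)\in\prod_n Y_n:y_m=f_{m,n}(y_n)\ \forall m\le n\}$ with the subspace topology of the product, and $\overline{f}_m$ is the restriction of the $m$-th coordinate projection. A projective sequence of CPSs $((Y_n,\Sigma_{Y_n},\mathcal{B}_n),f_{m,n},\mu_n)$ means: (i) $(Y_n,f_{m,n})$ is a projective sequence of Hausdorff spaces with surjective bonding maps; (ii) $\mathcal{B}_n\subseteq\Sigma_{Y_n}$ are conditioning families with $\mathcal{B}_n=f_{m,n}^{-1}(\mathcal{B}_m)$ for $m\le n$; (iii) $\mu_n$ is a CPS on $(Y_n,\Sigma_{Y_n},\mathcal{B}_n)$; (iv) $\mu_m=\overline{\mathcal{L}}_{f_{m,n}}(\mu_n)$ for $m\le n$. Its CPS projective limit is $((Y,\Sigma_Y,\mathcal{B}_Y),\overline{f}_n,\mu)$ with $Y=\varprojlim Y_n$, $\mathcal{B}_Y=\overline{f}_n^{-1}(\mathcal{B}_n)$ for all $n$, and $\mu$ (the limit CPS) a CPS on $(Y,\Sigma_Y,\mathcal{B}_Y)$ with $\overline{\mathcal{L}}_{\overline{f}_n}(\mu)=\mu_n$ for all $n$. *)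

(* Defs.v *)
From HB Require Import structures.
From mathcomp Require Import all_boot all_order all_algebra.
From mathcomp Require Import all_classical all_reals all_analysis.
Set Implicit Arguments.
Unset Strict Implicit.
Unset Printing Implicit Defensive.
Import Order.TTheory GRing.Theory Num.Theory.
Local Open Scope classical_set_scope.
Local Open Scope ring_scope.

Definition borel (T : topologicalType) : set (set T) := <<s @open T >>.

(* Borel probability measure, given as a set function (only its values on
   Borel sets matter). *)
Definition borel_probability (T : topologicalType) (R : realType)
  (P : set T -> \bar R) : Prop :=
  [/\ P set0 = 0%E,
      (forall A, borel A -> (0 <= P A)%E),
      (forall F : nat -> set T, (forall i, borel (F i)) -> trivIset setT F ->
         (fun n => \sum_(0 <= i < n) P (F i))%E @ \oo --> P (\bigcup_n F n))
    & P setT = 1%E].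

Definition conditioning_family (T : topologicalType) (B : set (set T)) : Prop :=
  [/\ B !=set0, ~ B set0 & B `<=` @borel T].

(* Conditional probability system on (X, Sigma_X, B);
   mu A C stands for mu(A | C). *)
Definition CPS (T : topologicalType) (R : realType) (B : set (set T))
  (mu : set T -> set T -> \bar R) : Prop :=
  [/\ (forall C, B C -> borel_probability (fun A => mu A C)),
      (forall C, B C -> mu C C = 1%E)
    & (forall A B1 C, borel A -> B B1 -> B C -> A `<=` B1 -> B1 `<=` C ->
         (mu A B1 * mu B1 C)%E = mu A C)].

Definition preimage_family (X Y : Type) (f : X -> Y) (B : set (set Y))
  : set (set X) := [set f @^-1` C | C in B].

Definition image_CPS (X Y : Type) (R : realType) (f : X -> Y)
  (mu : set X -> set X -> \bar R) : set Y -> set Y -> \bar R :=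
  fun E C => mu (f @^-1` E) (f @^-1` C).

Definition projective_sequence_CPS (R : realType) (Y : nat -> topologicalType)
  (f : forall m n : nat, Y n -> Y m) (B : forall n, set (set (Y n)))
  (mu : forall n, set (Y n) -> set (Y n) -> \bar R) : Prop :=
  [/\
      [/\ (forall n, hausdorff_space (Y n)), (forall n, exists y : Y n, True)
         & (forall m n, (m <= n)%N ->
              continuous (f m n) /\ (forall y : Y m, exists x : Y n, f m n x = y))],
      ((forall m n p, (m <= n <= p)%N -> f m p = f m n \o f n p) /\
       (forall n, f n n = id)),
      ((forall n, conditioning_family (B n)) /\
       (forall m n, (m <= n)%N -> B n = preimage_family (f m n) (B m))),
      (forall n, CPS (B n) (mu n))
    &
      (forall m n, (m <= n)%N -> forall E C, borel E -> B m C ->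
         mu m E C = image_CPS (f m n) (mu n) E C)].

Definition souslin (R : realType) (T : topologicalType) : Prop :=
  exists Z : completePseudoMetricType R,
    [/\ hausdorff_space Z,
        (exists D : set Z, countable D /\ dense D)
      & exists g : Z -> T, continuous g /\ g @` setT = setT].

Definition projlim_set (Y : nat -> topologicalType)
  (f : forall m n : nat, Y n -> Y m) : set (prod_topology Y) :=
  [set y | forall m n, (m <= n)%N -> y m = f m n (y n)].

(* ... and as a topological space with the subspace topology of the product
   topology. *)
Definition projlim (Y : nat -> topologicalType)
  (f : forall m n : nat, Y n -> Y m) : topologicalType :=
  [the topologicalType of set_type (projlim_set f)].

Definition fbar (Y : nat -> topologicalType) (f : forall m n : nat, Y n -> Y m)
  (n : nat) : projlim f -> Y n := fun y => (set_val y) n.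
Arguments fbar {Y} f n _.

(* B_Y := \overline{f}_1^{-1}(B_1) (index 0 here, as N starts at 0). *)
Definition projlim_family (Y : nat -> topologicalType)
  (f : forall m n : nat, Y n -> Y m) (B : forall n, set (set (Y n)))
  : set (set (projlim f)) := preimage_family (fbar f 0) (B 0).
Arguments projlim_family {Y} f B _.

Definition limit_CPS (R : realType) (Y : nat -> topologicalType)
  (f : forall m n : nat, Y n -> Y m) (B : forall n, set (set (Y n)))
  (mu : forall n, set (Y n) -> set (Y n) -> \bar R)
  (muY : set (projlim f) -> set (projlim f) -> \bar R) : Prop :=
  CPS (projlim_family f B) muY /\
  (forall n E C, borel E -> B n C ->
     image_CPS (fbar f n) muY E C = mu n E C).
Arguments limit_CPS {R Y} f B mu muY.

(* Main.v *)
Require Import Defs.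
From HB Require Import structures.
From mathcomp Require Import all_boot all_order all_algebra.
From mathcomp Require Import all_classical all_reals all_analysis.
From mathcomp Require Import lra.
Set Implicit Arguments.
Unset Strict Implicit.
Unset Printing Implicit Defensive.
Import Order.TTheory GRing.Theory Num.Theory.
Local Open Scope classical_set_scope.
Local Open Scope ring_scope.

(** A projective system of probabilities [mu n] on Souslin spaces defines a
    finitely additive content on the algebra of cylinders of the limit. Borel
    probabilities on Souslin metric spaces are inner regular for compact sets,
    so for a decreasing sequence of cylinders of content at least [e] one finds
    compact bases losing less than [e] altogether; an ultrafilter containing
    the corresponding compact cylinders converges levelwise to a point of their
    intersection. Hence the content is continuous at the empty set and
    Caratheodory's theorem extends it to the Borel sets, which are generated by
    the cylinders. Applied to [mu n (. | f_{0,n}^{-1} C)] for each conditioning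
    event [C], this yields the limit array; the chain rule and uniqueness hold
    on cylinders, a pi-system, and so everywhere. *)

(** * Borel sets *)

Lemma borel0 (T : topologicalType) : borel (@set0 T).
Proof. exact: sigma_algebra0. Qed.

Lemma borelC (T : topologicalType) (A : set T) : borel A -> borel (~` A).
Proof. by rewrite -setTD; exact: sigma_algebraCD. Qed.

Lemma borel_bigcup (T : topologicalType) (F : (set T)^nat) :
  (forall i, borel (F i)) -> borel (\bigcup_i F i).
Proof. exact: sigma_algebra_bigcup. Qed.

(* The measure hierarchy of the library lives on pointed types, and [T] need not
   be one: [x] serves as the point. *)
Definition borel_at (T : topologicalType) (x : T) : Type := T.

HB.instance Definition _ T x := Choice.on (@borel_at T x).
HB.instance Definition _ T x := isPointed.Build (@borel_at T x) x.
HB.instance Definition _ T x := @isMeasurable.Build (sigma_display (@open T))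
  (@borel_at T x) (@borel T) (@borel0 T) (@borelC T) (@borel_bigcup T).

Section borel_closure.
Context (T : topologicalType).
Implicit Types A B : set T.

Lemma borelT : borel [set: T].
Proof. by rewrite -setC0; apply: borelC; exact: borel0. Qed.

Lemma borel_open A : open A -> borel A.
Proof. exact: sub_sigma_algebra. Qed.

Lemma borel_closed A : closed A -> borel A.
Proof. by rewrite -openC -{2}(setCK A) => /borel_open; exact: borelC. Qed.

Lemma borelI A B : borel A -> borel B -> borel (A `&` B).
Proof.
have [->|/set0P[x _]] := eqVneq A set0; first by rewrite set0I.
exact: (@measurableI _ (borel_at x)).
Qed.

Lemma borelU A B : borel A -> borel B -> borel (A `|` B).
Proof.
by move=> bA bB; rewrite -[_ `|` _]setCK setCU; apply: borelC; apply: borelI; exact: borelC.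
Qed.

Lemma borelD A B : borel A -> borel B -> borel (A `\` B).
Proof. by move=> bA bB; rewrite setDE; apply: borelI => //; exact: borelC. Qed.

Lemma borel_bigcap (F : (set T)^nat) :
  (forall i, borel (F i)) -> borel (\bigcap_i F i).
Proof.
move=> bF; rewrite -[X in borel X]setCK setC_bigcap; apply: borelC; apply: borel_bigcup.
by move=> i; exact: borelC.
Qed.

Lemma borel_bigsetU (F : (set T)^nat) n :
  (forall i, borel (F i)) -> borel (\big[setU/set0]_(i < n) F i).
Proof. by move=> bF; elim/big_ind: _ => //; [exact: borel0|exact: borelU]. Qed.

End borel_closure.

Lemma borel_preimage (S T : topologicalType) (f : S -> T) (A : set T) :
  continuous f -> borel A -> borel (f @^-1` A).
Proof.
move=> /continuousP cf.
apply: (smallest_sub (X := [set A | borel (f @^-1` A)])) => [|B oB].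
  split => [|B bB|F bF]; rewrite /mkset/=.
  - by rewrite preimage_set0; exact: borel0.
  - by rewrite setTD preimage_setC; exact: borelC.
  - by rewrite preimage_bigcup; exact: borel_bigcup.
by apply: borel_open; exact: cf.
Qed.

(** * Borel probabilities and their elementary properties *)

Section borel_probability_theory.
Context (R : realType) (T : topologicalType) (P : set T -> \bar R).
Hypothesis hP : borel_probability P.
Local Open Scope ereal_scope.

Lemma borel_probability_inhabited : exists x : T, True.
Proof.
apply: contrapT => noT; have [P0 _ _ P1] := hP.
suff ST : [set: T] = set0.
  by move: P1; rewrite ST P0 => /eqP; rewrite eqe eq_sym oner_eq0.
by apply/seteqP; split=> x // _; apply: noT; exists x.
Qed.

(** Bridge to the measure theory of the library: the [bprob] facts below are obtained by transport
    along it. *)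
Lemma borel_probability_measure (x : T) :
  exists m : probability (borel_at x) R, forall A, borel A -> m A = P A.
Proof.
have [P0 Pge0 Psum PT] := hP.
(* Nonnegativity has to hold on every set, while [P] is controlled on Borel sets only; hence the
   value 0 elsewhere. *)
pose p (A : set (borel_at x)) := if pselect (borel A) then P A else 0.
have pE A : borel A -> p A = P A by rewrite /p; case: pselect.
have p0 : p set0 = 0 by rewrite pE ?P0//; exact: borel0.
have pge0 A : 0 <= p A by rewrite /p; case: pselect => // bA; exact: Pge0.
have psum : semi_sigma_additive p.
  move=> F mF tF mUF; rewrite (pE _ mUF).
  under eq_fun do under eq_bigr do rewrite (pE _ (mF _)).
  exact: Psum.
have pT : p setT = 1 by rewrite pE ?PT//; exact: borelT.
pose mp := isMeasure.Build _ _ _ p p0 pge0 psum.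
pose mu : {measure set (borel_at x) -> \bar R} := HB.pack p mp.
pose pp := Measure_isProbability.Build _ _ _ mu pT.
pose m : probability (borel_at x) R := HB.pack (Measure.sort mu) pp.
by exists m.
Qed.

End borel_probability_theory.

Section borel_probability_facts.
Context (R : realType) (T : topologicalType) (P : set T -> \bar R).
Hypothesis hP : borel_probability P.
Implicit Types A B : set T.
Local Open Scope ereal_scope.

Lemma bprob_ge0 A : borel A -> 0 <= P A.
Proof. by case: hP => _ + _ _; exact. Qed.

Lemma bprob_le A B : borel A -> borel B -> A `<=` B -> P A <= P B.
Proof.
move=> bA bB AB; have [x _] := borel_probability_inhabited hP.
have [m mE] := borel_probability_measure hP x.
by rewrite -!mE//; apply: le_measure; rewrite ?inE.
Qed.

Lemma bprob_le1 A : borel A -> P A <= 1.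
Proof. by move=> bA; have [_ _ _ <-] := hP; exact: bprob_le bA (@borelT _) _. Qed.

Lemma bprob_fin A : borel A -> P A \is a fin_num.
Proof.
move=> bA; rewrite ge0_fin_numE ?bprob_ge0//.
by rewrite (le_lt_trans (bprob_le1 bA))// ltry.
Qed.

Lemma bprobID A B : borel A -> borel B -> P A = P (A `\` B) + P (A `&` B).
Proof.
move=> bA bB; have [x _] := borel_probability_inhabited hP.
have [m mE] := borel_probability_measure hP x.
rewrite -!mE//; [exact: measureDI|exact: borelI|exact: borelD].
Qed.

Lemma bprobC A : borel A -> P A + P (~` A) = 1.
Proof.
move=> bA; have [_ _ _ <-] := hP.
by rewrite (bprobID (@borelT _) bA) setTD setTI addeC.
Qed.

Lemma bprobU2 A B : borel A -> borel B -> P (A `|` B) <= P A + P B.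
Proof.
move=> bA bB; have [x _] := borel_probability_inhabited hP.
have [m mE] := borel_probability_measure hP x.
by rewrite -!mE//; [exact: measureU2|exact: borelU].
Qed.

Lemma bprob_bigcup_le A (F : (set T)^nat) : (forall i, borel (F i)) ->
  borel A -> A `<=` \bigcup_i F i -> P A <= \sum_(i <oo) P (F i).
Proof.
move=> bF bA AF; have [x _] := borel_probability_inhabited hP.
have [m mE] := borel_probability_measure hP x.
rewrite -mE//; under eq_eseriesr do rewrite -mE//.
exact: measure_sigma_subadditive.
Qed.

Lemma bprob_nondecreasing_cvg (F : (set T)^nat) : (forall i, borel (F i)) ->
  nondecreasing_seq F -> P (F i) @[i --> \oo] --> P (\bigcup_i F i).
Proof.
move=> bF ndF; have [x _] := borel_probability_inhabited hP.
have [m mE] := borel_probability_measure hP x.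
rewrite -mE; last exact: borel_bigcup.
under eq_fun do rewrite -mE//.
by apply: nondecreasing_cvg_mu => //; exact: borel_bigcup.
Qed.

Lemma bprob_nonincreasing_cvg (F : (set T)^nat) : (forall i, borel (F i)) ->
  nonincreasing_seq F -> P (F i) @[i --> \oo] --> P (\bigcap_i F i).
Proof.
move=> bF niF; have [x _] := borel_probability_inhabited hP.
have [m mE] := borel_probability_measure hP x.
rewrite -mE; last exact: borel_bigcap.
under eq_fun do rewrite -mE//.
apply: nonincreasing_cvg_mu => //; last exact: borel_bigcap.
by apply: (@le_lt_trans _ _ 1); [apply: (probability_le1 m); exact: bF|exact: ltry].
Qed.

Lemma bprob_nondecreasing_le (F : (set T)^nat) (c : \bar R) :
  (forall i, borel (F i)) -> nondecreasing_seq F ->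
  (forall i, P (F i) <= c) -> P (\bigcup_i F i) <= c.
Proof.
move=> bF ndF Fc; have FP := bprob_nondecreasing_cvg bF ndF.
rewrite -(cvg_lim _ FP)//; apply: lime_le; first by apply/cvg_ex; eexists; exact: FP.
exact: nearW.
Qed.

Lemma bprob_nonincreasing_ge (F : (set T)^nat) (c : \bar R) :
  (forall i, borel (F i)) -> nonincreasing_seq F ->
  (forall i, c <= P (F i)) -> c <= P (\bigcap_i F i).
Proof.
move=> bF niF Fc; have FP := bprob_nonincreasing_cvg bF niF.
rewrite -(cvg_lim _ FP)//; apply: lime_ge; first by apply/cvg_ex; eexists; exact: FP.
exact: nearW.
Qed.

Lemma bprob_nonincreasing_lt (F : (set T)^nat) (e : R) : (0 < e)%R ->
  (forall i, borel (F i)) -> nonincreasing_seq F ->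
  \bigcap_i F i = set0 -> exists n, P (F n) < e%:E.
Proof.
move=> e0 bF niF F0; apply: contrapT => /forallNP nF.
have : e%:E <= P (\bigcap_i F i).
  by apply: bprob_nonincreasing_ge => // i; rewrite leNgt; apply/negP/nF.
by have [P0 _ _ _] := hP; rewrite F0 P0 lee_fin leNgt e0.
Qed.

End borel_probability_facts.

(** * Uniqueness on pi-systems *)

(** Shaped for the chain rule, which says that mu(.|D), scaled by k = mu(D|C), and mu(.|C) agree on
    the subsets of D. Both traces on [D] are finite measures, so agreement on a pi-system containing
    the whole space suffices. *)
Lemma bprob_scale_trace_eq (R : realType) (T : topologicalType)
    (G : set (set T)) (P Q : set T -> \bar R) (D : set T) (k : R) : 0 <= k ->
  borel_probability P -> borel_probability Q -> borel D ->
  @borel T = <<s G >> -> setI_closed G -> G setT ->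
  (forall A, G A -> (k%:E * P (A `&` D) = Q (A `&` D))%E) ->
  forall A, borel A -> (k%:E * P (A `&` D) = Q (A `&` D))%E.
Proof.
move=> k0 hP hQ bD bG GI GT PQ A bA; have [x _] := borel_probability_inhabited hP.
have [m mE] := borel_probability_measure hP x.
have [m' mE'] := borel_probability_measure hQ x.
have sGb B : G B -> borel B by rewrite bG; exact: sub_sigma_algebra.
have bD' : measurable (D : set (borel_at x)) by [].
pose m1 := mscale (NngNum k0) (mrestr m bD').
have m1E B : borel B -> m1 B = (k%:E * P (B `&` D))%E.
  by move=> bB; rewrite -mE//; exact: borelI.
have m2E B : borel B -> mrestr m' bD' B = Q (B `&` D).
  by move=> bB; rewrite -mE'//; exact: borelI.
rewrite -m1E// -m2E//.
apply: (@measure_unique _ _ (borel_at x) G (fun=> setT)) => //.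
- by rewrite bigcup_const.
- by move=> B GB; have bB := sGb B GB; rewrite [LHS]m1E// [RHS]m2E// PQ.
- move=> _; rewrite [ltLHS]m1E; last exact: borelT.
  by rewrite PQ// ltey_eq bprob_fin// setTI.
Qed.

Lemma bprob_eq (R : realType) (T : topologicalType) (G : set (set T))
    (P Q : set T -> \bar R) :
  borel_probability P -> borel_probability Q ->
  @borel T = <<s G >> -> setI_closed G -> G setT ->
  (forall A, G A -> P A = Q A) -> forall A, borel A -> P A = Q A.
Proof.
move=> hP hQ bG GI GT PQ A bA.
have /(_ _ A bA) := @bprob_scale_trace_eq _ _ G P Q setT 1 ler01 hP hQ
  (@borelT T) bG GI GT.
by rewrite setIT mul1e; apply => B GB; rewrite setIT mul1e PQ.
Qed.

(** * Approximation by closed and open sets *)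

(** Close up the set of points whose ball of radius 1/(n+1) lies in [A]: a limit point is that close
    to such a point, so it is still in [A]. *)
Lemma open_bigcup_closed (R : realType) (T : pseudoMetricType R) (A : set T) :
  open A -> exists F : (set T)^nat,
    [/\ forall i, closed (F i), nondecreasing_seq F & \bigcup_i F i = A].
Proof.
move=> oA; exists (fun n => closure [set x | ball x n.+1%:R^-1 `<=` A]); split.
- by move=> i; exact: closed_closure.
- move=> m n mn; apply/subsetPset/closureS => x /=; apply: subset_trans.
  by apply: le_ball; rewrite lef_pV2 ?posrE// ler_nat.
apply/seteqP; split=> [y [n _ clSy]|y Ay].
  have [x [xA yx]] := clSy _ (nbhsx_ballx y n.+1%:R^-1 (ltac:(by rewrite invr_gt0))).
  by apply: xA; exact: ball_sym.
have /nbhs_ballP[e /= e0 yeA] : nbhs y A by exact: open_nbhs_nbhs.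
have [n _ /(_ n (leqnn _)) ne] := near_infty_natSinv_lt (PosNum e0).
exists n => //; apply: subset_closure => /= z yz; apply: yeA.
exact: le_ball (ltW ne) _ yz.
Qed.

(** The sets with such approximations form a sigma-algebra, complements exchanging the closed and
    the open set, and it contains the open sets. *)
Lemma bprob_regular (R : realType) (T : pseudoMetricType R) (P : set T -> \bar R) :
  borel_probability P -> forall A, borel A -> forall e : R, 0 < e ->
  exists F U, [/\ closed F, open U, F `<=` A, A `<=` U & (P (U `\` F) < e%:E)%E].
Proof.
move=> hP; apply: smallest_sub.
  split.
  - move=> e e0; exists set0, set0; split=> //; first exact: closed0.
      exact: open0.
    by rewrite setD0; have [-> _ _ _] := hP; rewrite lte_fin.
  - move=> A rA e /rA[F [U [cF oU FA AU PUF]]]; exists (~` U), (~` F); split.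
    + exact: open_closedC.
    + exact: closed_openC.
    + by rewrite setTD; exact: subsetC.
    + by rewrite setTD; exact: subsetC.
    + by rewrite setDE setCK setIC -setDE.
  - move=> A rA e e0.
    (* A countable union of closed sets need not be closed: one half of [e] pays for all the
       differences [U i] minus [F i], the other for keeping only finitely many of the [F i]. *)
    have e20 : 0 < e / 2 by rewrite divr_gt0.
    have en i : 0 < e / 2 / (2 ^ i.+1)%:R by rewrite divr_gt0// ltr0n expn_gt0.
    have {}rA i := rA i _ (en i).
    pose F i := projT1 (cid (rA i)).
    pose U i := projT1 (cid (projT2 (cid (rA i)))).
    have FUP i : [/\ closed (F i), open (U i), F i `<=` A i, A i `<=` U i &
        (P (U i `\` F i) < (e / 2 / (2 ^ i.+1)%:R)%:E)%E].
      by rewrite /U /F; case: cid => f /= H; case: cid.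
    have bF i : borel (F i) by have [+ _ _ _ _] := FUP i; exact: borel_closed.
    have bU i : borel (U i) by have [_ + _ _ _] := FUP i; exact: borel_open.
    pose FN n := \big[setU/set0]_(i < n) F i.
    have bFN n : borel (FN n) by exact: borel_bigsetU.
    have [|||n Pn] := bprob_nonincreasing_lt (F := fun n => (\bigcup_i F i) `\` FN n)
        hP e20.
    + by move=> n; apply: borelD => //; exact: borel_bigcup.
    + move=> m n mn; apply/subsetPset; apply: setDS.
      by rewrite /FN -!bigcup_mkord => x [i /= im Fx]; exists i => //=; exact: leq_trans mn.
    + rewrite -subset0 => x nFx; have [[i _ Fix] _] := nFx 0%N I.
      have [_ /(_ _)] := nFx i.+1 I; apply.
      by rewrite /FN -bigcup_mkord; exists i => /=.
    exists (FN n), (\bigcup_i U i); split.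
    + by apply: closed_bigsetU => i _; have [] := FUP i.
    + by apply: bigcup_open => i _; have [] := FUP i.
    + rewrite /FN -bigcup_mkord => x [i _ Fx]; exists i => //.
      by have [_ _ + _ _] := FUP i; exact.
    + by apply: subset_bigcup => i _; have [] := FUP i.
    have bUF i : borel (U i `\` F i) by exact: borelD.
    have PUF : (P (\bigcup_i (U i `\` F i)) <= (e / 2)%:E)%E.
      apply: le_trans (epsilon_trick0 xpredT (ltW e20)).
      apply: le_trans (bprob_bigcup_le hP bUF (borel_bigcup bUF) _) _ => //.
      apply: lee_nneseries => [i _ _|i _]; first exact: bprob_ge0.
      by apply: ltW; have [] := FUP i.
    apply: (@le_lt_trans _ _
      (P ((\bigcup_i (U i `\` F i)) `|` ((\bigcup_i F i) `\` FN n)))).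
      apply: bprob_le => //.
      * by apply: borelD => //; exact: borel_bigcup.
      * by apply: borelU; [exact: borel_bigcup|apply: borelD => //; exact: borel_bigcup].
      * move=> x [[i _ Ux] nFx]; have [[j _ Fx]|nF] := pselect ((\bigcup_i F i) x).
          by right; split => //; exists j.
        by left; exists i => //; split => // Fx; apply: nF; exists i.
    apply: le_lt_trans (bprobU2 hP _ _) _ => //.
    + exact: borel_bigcup.
    + by apply: borelD => //; exact: borel_bigcup.
    rewrite [e in ltRHS]splitr EFinD; apply: lee_ltD => //.
    by rewrite ge0_fin_numE ?bprob_ge0// ?(le_lt_trans PUF) ?ltry//; exact: borel_bigcup.
move=> A oA e e0.
have [F [cF ndF FA]] := open_bigcup_closed oA.
have [|||n Pn] := bprob_nonincreasing_lt (F := fun n => A `\` F n) hP e0.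
- by move=> n; apply: borelD; [exact: borel_open|exact: borel_closed].
- by move=> m n mn; apply/subsetPset; apply: setDS; exact/subsetPset/ndF.
- rewrite -subset0 => x nFx; have [+ _] := nFx 0%N I.
  by rewrite -FA => -[i _ Fix]; have [_ /(_ Fix)] := nFx i I.
exists (F n), A; split => //.
by rewrite -FA; exact: bigcup_sup.
Qed.

Lemma bprob_EFin (R : realType) (T : topologicalType) (P : set T -> \bar R) :
  borel_probability P ->
  exists p : set T -> R, forall A, borel A -> P A = (p A)%:E.
Proof.
move=> hP; exists (fine \o P) => A bA /=.
by rewrite fineK//; exact: bprob_fin.
Qed.

(** * Compact inner regularity on Souslin spaces *)

Lemma dense_sequence (T : ptopologicalType) (D : set T) :
  countable D -> dense D -> exists z : nat -> T, dense (range z).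
Proof.
move=> /countable_injP[g ginj] dD.
(* Indices that enumerate nothing are sent to [point]; enlarging the range does not harm density. *)
exists (fun n => xget point [set x | D x /\ g x = n]) => U U0 oU.
have [x [Ux Dx]] := dD U U0 oU; exists x; split => //; exists (g x) => //.
case: xgetP => [y _ [Dy gy]|/(_ x)/not_andP[]//].
by apply: ginj; rewrite ?inE.
Qed.

Lemma ultra_bigcup_finite (T : Type) (F : set_system T) (B : (set T)^nat) n :
  UltraFilter F -> F (\bigcup_(k in `I_n) B k) -> exists k, F (B k).
Proof.
move=> FU; elim: n => [|n IH]; first by rewrite II0 bigcup_set0 => /filter_not_empty.
rewrite IIS bigcup_setU bigcup_set1 => FUn.
have [|FnB] := in_ultra_setVsetC (B n) FU; first by exists n.
by apply: IH; apply: filterS (filterI FUn FnB) => x [[|]].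
Qed.

(** An ultrafilter containing a finite union contains one of its members, hence here a ball of every
    radius; so it is Cauchy. *)
Lemma ultra_totally_bounded_cvg (R : realType) (Z : completePseudoMetricType R)
    (z : nat -> Z) (F : set_system Z) : UltraFilter F ->
  (forall e : R, 0 < e -> exists n, F (\bigcup_(k in `I_n) ball (z k) e)) ->
  exists p : Z, F --> p.
Proof.
move=> FU Fb; suff : [cvg F in Z] by move=> Fcv; exists [lim F in Z].
apply: cauchy_cvg; apply: cauchy_exP => e /Fb[n].
by move=> /ultra_bigcup_finite[k Fk]; exists (z k).
Qed.

Section souslin_tightness.
Context (R : realType) (T : topologicalType) (P : set T -> \bar R).
Hypothesis hP : borel_probability P.

(* [above_outer c A] says that the outer measure of [A] is above [c], in the
   form that passes to increasing unions of arbitrary sets without any loss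
   on [c]. *)
Definition above_outer (c : \bar R) (A : set T) :=
  forall B, borel B -> A `<=` B -> (c < P B)%E.

(** Continuity from below of outer measure. If every [A n] had a Borel cover [B n] of measure at
    most [c], the intersections of the tails of [B] would still cover, increase, and have a union of
    measure at most [c]. *)
Lemma above_outer_bigcup c (A : (set T)^nat) : nondecreasing_seq A ->
  above_outer c (\bigcup_n A n) -> exists n, above_outer c (A n).
Proof.
move=> ndA cA; apply: contrapT => /forallNP nA.
have {nA} /choice[B HB] n : exists B, [/\ borel B, A n `<=` B & (P B <= c)%E].
  have /existsNP[B /not_implyP[bB /not_implyP[AB /negP]]] := nA n.
  by rewrite -leNgt; exists B.
have bB n : borel (B n) by case: (HB n).
pose E n := \bigcap_k B (n + k)%N.
have bE n : borel (E n) by exact: borel_bigcap.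
have : (P (\bigcup_n E n) <= c)%E.
  apply: bprob_nondecreasing_le => // [m n mn|n].
    by apply/subsetPset => x Ex k _; rewrite -(subnKC mn) -addnA; exact: Ex.
  have [_ _ Bc] := HB n; apply: le_trans Bc; apply: bprob_le => //.
  by move=> x /(_ 0%N I); rewrite addn0.
apply/negP; rewrite -ltNge; apply: cA; first exact: borel_bigcup.
move=> x [n _ Ax]; exists n => // k _; have [_ + _] := HB (n + k)%N; apply.
by move: x Ax; apply/subsetPset/ndA/leq_addr.
Qed.

Context (Z : completePseudoMetricType R) (g : Z -> T) (z : nat -> Z).
Hypotheses (dz : dense (range z)) (cg : continuous g) (gT : g @` setT = setT).

Let r (i : nat) : R := i.+1%:R^-1.
Let r_gt0 i : 0 < r i. Proof. by rewrite invr_gt0. Qed.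

Let above_cover c i (S : set Z) : above_outer c (g @` S) ->
  exists n, above_outer c (g @` (S `&` \bigcup_(k in `I_n) ball (z k) (r i))).
Proof.
move=> cS; apply: above_outer_bigcup => [m n mn|].
  apply/subsetPset; apply: image_subset; apply: setIS => x [k /= km xk].
  by exists k => //=; exact: leq_trans mn.
move=> B bB SB; apply: cS => // _ [x Sx <-]; apply: SB.
(* Balls of a pseudometric need not be open, so density is applied to the interior. *)
have [|y [xy [k _ zy]]] := dz _ (open_interior (ball x (r i))).
  by exists x; exact: nbhsx_ballx.
exists k.+1 => //; exists x => //; split => //; exists k => //=.
by rewrite zy; apply: ball_sym; exact: interior_subset.
Qed.

(** Cut [Z] down successively to finite unions of smaller and smaller balls, keeping the outer
    measure of the image above [c]. The closures meet in a compact set, and an open set containing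
    its image already contains the image of some stage. *)
Lemma above_outer_compact (c : \bar R) : (c < 1)%E -> exists2 K, compact K &
  forall U, open U -> K `<=` U -> (c < P U)%E.
Proof.
move=> c1.
(* The number of balls is chosen for every pair of a stage and a set; it is an arbitrary 0 where the
   image is not above [c]. *)
have /choice[N HN] : forall iS : nat * set Z, exists n,
    above_outer c (g @` iS.2) ->
    above_outer c (g @` (iS.2 `&` \bigcup_(k in `I_n) ball (z k) (r iS.1))).
  move=> [i S] /=; have [/(above_cover i)[n Sn]|nS] := pselect (above_outer c (g @` S)).
    by exists n.
  by exists 0%N.
pose C i S := S `&` \bigcup_(k in `I_(N (i, S))) ball (z k) (r i).
pose K := fix K i := if i is j.+1 then C j (K j) else setT.
have cK i : above_outer c (g @` K i).
  elim: i => [|i /(HN (i, _))//]; rewrite /= gT => B bB TB.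
  by have -> : B = setT by [apply/seteqP; split]; have [_ _ _ ->] := hP.
have niK m n : (m <= n)%N -> K n `<=` K m.
  elim: n => [|n IH]; first by rewrite leqn0 => /eqP ->.
  by rewrite leq_eqVlt => /orP[/eqP->//|/IH KK]; apply: subset_trans KK => x [].
pose K' := \bigcap_i closure (K i).
(* Used twice: for the compactness of [K'], and for the point that [U] would have missed. *)
have Kcvg (F : set_system Z) : UltraFilter F -> (forall i, F (closure (K i))) ->
    exists2 p : Z, K' p & F --> p.
  move=> FU FK; have [e e0|p Fp] := ultra_totally_bounded_cvg (z := z) FU.
    (* Radius e/2, because a point of the closure is one more radius away from a point of the
       ball. *)
    have [i _ /(_ i (leqnn _)) ie] := near_infty_natSinv_lt (PosNum (divr_gt0 e0 (ltr0n R 2))).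
    exists (N (i, K i)); apply: filterS (FK i.+1) => x Kx.
    have [y [[_ [k kN zy]] xy]] := Kx _ (nbhsx_ballx x _ (r_gt0 i)).
    exists k => //; apply: le_ball (ball_triangle zy (ball_sym xy)).
    by rewrite [leRHS]splitr lerD// ltW.
  exists p => // i _; apply: closed_closure.
  move=> V pV; have /filter_ex[x] : F (closure (K i) `&` V) by exact/filterI/Fp.
  by exists x.
exists (g @` K').
  apply: continuous_compact; first exact: continuous_subspaceT.
  rewrite compact_ultra => F FU FK'; have [|p K'p Fp] := Kcvg F FU; last by exists p.
  by move=> i; apply: filterS FK' => x; exact.
move=> U oU KU; suff [i KiU] : exists i, K i `<=` g @^-1` U.
  by apply: (cK i) (borel_open oU) _ => _ [x Kx <-]; exact: KiU Kx.
apply: contrapT => /forallNP nK.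
have {nK} /choice[x Hx] i : exists x, K i x /\ ~ U (g x).
  by have /existsNP[x /not_implyP] := nK i; exists x.
(* An ultrafilter containing the tails of [x] converges to a point of [K'], whose image lies in [U]
   although every [g (x i)] avoids [U]. *)
have [G [GU xG]] := ultraFilterLemma (fmap_proper_filter x eventually_filter).
have [i|p K'p Gp] := Kcvg G GU.
  apply: xG; exists i => // j /= ij; apply: subset_closure.
  by apply: (niK i j ij); have [] := Hx j.
have GUg : G (g @^-1` U).
  by apply: Gp; apply: cg; apply: open_nbhs_nbhs; split=> //; apply: KU; exists p.
have GnU : G (~` (g @^-1` U)).
  by apply: xG; exists 0%N => // i _ /=; have [] := Hx i.
have /filter_ex[y []//] : G (g @^-1` U `&` ~` (g @^-1` U)) by exact: filterI.
Qed.

End souslin_tightness.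

(** Outer regularity turns the bound on open neighbourhoods into one on the compact set itself; each
    of the two steps costs e/2. *)
Lemma souslin_tight (R : realType) (T : metricType R) (P : set T -> \bar R) :
  borel_probability P -> souslin R T -> forall e : R, 0 < e ->
  exists2 K, compact K & (P (~` K) < e%:E)%E.
Proof.
move=> hP [Z [_ [D [cD dD]] [g [cg gT]]]] e e0.
have [z dz] := dense_sequence cD dD.
have e20 : 0 < e / 2 by rewrite divr_gt0.
have [|K cK KU] := above_outer_compact hP dz cg gT (c := (1 - e / 2)%:E).
  by rewrite lte_fin ltrBlDr ltrDl.
exists K => //.
have clK : closed K by apply: compact_closed => //; exact: metric_hausdorff.
have bK := borel_closed clK.
have [F [U [cF oU FK KsU UF]]] := bprob_regular hP bK e20.
have bU := borel_open oU; have bF := borel_closed cF.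
have := KU U oU KsU; have : (P (U `\` K) <= P (U `\` F))%E.
  by apply: bprob_le => //; [exact: borelD|exact: borelD|exact: setDS].
have := bprobC hP bK; have := bprobID hP bU bK; move: UF.
rewrite (setIidr KsU).
have [p pE] := bprob_EFin hP.
rewrite !pE; try by [|exact: borelD|exact: borelC].
rewrite -!EFinD !lee_fin !lte_fin => ? [?] [?] ? ?; lra.
Qed.

(** Intersect a closed inner approximation with a compact set of almost full measure. *)
Lemma souslin_compact_regular (R : realType) (T : metricType R)
    (P : set T -> \bar R) :
  borel_probability P -> souslin R T -> forall A, borel A ->
  forall e : R, 0 < e ->
  exists K, [/\ compact K, K `<=` A & (P (A `\` K) < e%:E)%E].
Proof.
move=> hP sT A bA e e0; have e20 : 0 < e / 2 by rewrite divr_gt0.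
have [K cK PK] := souslin_tight hP sT e20.
have [F [U [cF oU FA AU PUF]]] := bprob_regular hP bA e20.
have clK : closed K by apply: compact_closed => //; exact: metric_hausdorff.
have bF := borel_closed cF; have bK := borel_closed clK; have bU := borel_open oU.
exists (F `&` K); split.
- by rewrite setIC; exact: compact_closedI.
- by move=> x [/FA].
apply: (@le_lt_trans _ _ (P ((U `\` F) `|` ~` K))).
  apply: bprob_le => //; [|by apply: borelU; [exact: borelD|exact: borelC]|].
    by apply: borelD => //; exact: borelI.
  move=> x [Ax /not_andP[nF|nK]]; last by right.
  by left; split => //; exact: AU.
apply: le_lt_trans (bprobU2 hP (borelD bU bF) (borelC bK)) _.
by rewrite [e]splitr EFinD lteD.
Qed.

(** * Caratheodory extension of a content continuous at the empty set *)

(** A copy of [T] whose measurable sets are [G]; the closure proofs are parameters so that the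
    instance can be found from the type. *)
Definition algebra_at (T : choiceType) (x : T) (G : set (set T))
  (G0 : G set0) (GU : setU_closed G) (GC : setC_closed G) : Type := T.

HB.instance Definition _ T x G G0 GU GC :=
  Choice.on (@algebra_at T x G G0 GU GC).
HB.instance Definition _ T x G G0 GU GC :=
  isPointed.Build (@algebra_at T x G G0 GU GC) x.
HB.instance Definition _ T x G G0 GU GC :=
  @isAlgebraOfSets.Build (sigma_display G) (@algebra_at T x G G0 GU GC)
    G G0 GU GC.

Section extension.
Context (R : realType) (T : topologicalType) (G : set (set T)).
Context (mu : set T -> \bar R).
Hypotheses (G0 : G set0) (GU : setU_closed G) (GC : setC_closed G).
Hypothesis bG : @borel T = <<s G >>.
Hypotheses (muT : mu setT = 1%E) (mu_ge0 : forall A, G A -> (0 <= mu A)%E).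
Hypothesis muU : forall A B, G A -> G B -> A `&` B = set0 ->
  mu (A `|` B) = (mu A + mu B)%E.
Hypothesis mu_cont0 : forall (F : (set T)^nat) (e : R), 0 < e ->
  (forall i, G (F i)) -> nonincreasing_seq F -> \bigcap_i F i = set0 ->
  exists n, (mu (F n) < e%:E)%E.

Let GT : G setT. Proof. by rewrite -setC0; exact: GC. Qed.

Let GD A B : G A -> G B -> G (A `\` B).
Proof. by move=> GA GB; rewrite -[_ `\` _]setCK setCD; apply/GC/GU => //; exact: GC. Qed.

Let muID A B : G A -> G B -> B `<=` A -> mu A = (mu B + mu (A `\` B))%E.
Proof.
move=> GA GB BA; rewrite -muU//; [|exact: GD|exact: setDIK].
by rewrite setDUK.
Qed.

Let mu_le A B : G A -> G B -> A `<=` B -> (mu A <= mu B)%E.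
Proof. by move=> GA GB /(muID GB GA) ->; rewrite leeDl// mu_ge0//; exact: GD. Qed.

Let mu_fin A : G A -> mu A \is a fin_num.
Proof.
move=> GA; rewrite ge0_fin_numE ?mu_ge0//.
by rewrite (le_lt_trans (mu_le GA GT _))// muT ltry.
Qed.

Let mu0 : mu set0 = 0%E.
Proof.
have := muU G0 G0 (set0I _); rewrite set0U.
by move: (mu_fin G0); case: (mu set0) => //= r _ [?]; congr EFin; lra.
Qed.

Let mu_bigsetU (F : (set T)^nat) n : (forall i, G (F i)) -> trivIset setT F ->
  G (\big[setU/set0]_(i < n) F i) /\
  mu (\big[setU/set0]_(i < n) F i) = (\sum_(0 <= i < n) mu (F i))%E.
Proof.
move=> GF tF; elim: n => [|n [GFn IH]]; first by rewrite big_ord0 big_nil.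
rewrite big_ord_recr/= big_nat_recr//= -IH; split; first exact: GU.
apply: muU => //; apply: (@trivIset_bigsetUI _ predT) => //.
by rewrite /predT/= trueE.
Qed.

Let mu_sigma_additive (F : (set T)^nat) : (forall i, G (F i)) ->
  trivIset setT F -> G (\bigcup_i F i) ->
  (fun n => \sum_(0 <= i < n) mu (F i))%E @ \oo --> mu (\bigcup_i F i).
Proof.
move=> GF tF GUF; pose S n := \big[setU/set0]_(i < n) F i.
have GS n : G (S n) by have [] := mu_bigsetU n GF tF.
have SU n : S n `<=` \bigcup_i F i by exact: bigsetU_bigcup.
have ndS m n : (m <= n)%N -> S m `<=` S n.
  by move=> mn; rewrite /S -!bigcup_mkord => x [i im Fx]; exists i => //; exact: leq_trans mn.
pose D n := \bigcup_i F i `\` S n.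
have GDn n : G (D n) by exact: GD.
pose M := fine (mu (\bigcup_i F i)).
(* By finite additivity a partial sum misses the total by the content of the remainder [D n], and
   the remainders decrease to the empty set. *)
have muD n : (\sum_(0 <= i < n) mu (F i))%E = (M - fine (mu (D n)))%:E.
  have [_ <-] := mu_bigsetU n GF tF; rewrite /M (muID GUF (GS n) (SU n)) fineD; [|exact/mu_fin/GS|exact/mu_fin/GDn].
  by rewrite addrK fineK//; exact/mu_fin/GS.
have -> : mu (\bigcup_i F i) = M%:E by rewrite fineK//; exact: mu_fin.
under eq_fun do rewrite muD.
apply: cvg_EFin; first exact: nearW.
apply/cvgrPdist_lt => e e0.
have [//|||N HN] := mu_cont0 (F := D) e0.
- by move=> m n mn; apply/subsetPset; apply: setDS; exact: ndS.
- rewrite -subset0 => x nD; have [[i _ Fx] _] := nD 0%N I.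
  have [_] := nD i.+1 I; apply.
  by rewrite /S -bigcup_mkord; exists i => /=.
exists N => // n /= Nn; rewrite opprB addrC subrK ger0_norm.
  rewrite -lte_fin fineK ?mu_fin//; apply: le_lt_trans HN.
  by apply: mu_le => //; apply: setDS; exact: ndS.
by rewrite fine_ge0// mu_ge0.
Qed.

Lemma bprob_extension (x : T) : exists P : set T -> \bar R,
  borel_probability P /\ forall A, G A -> P A = mu A.
Proof.
pose p (A : set (algebra_at x G0 GU GC)) := if pselect (G A) then mu A else 0%E.
have pE A : G A -> p A = mu A by rewrite /p; case: pselect.
have p0 : p set0 = 0%E by rewrite pE.
have pge0 A : (0 <= p A)%E by rewrite /p; case: pselect => // GA; exact: mu_ge0.
have psum : semi_sigma_additive p.
  move=> F mF tF mUF; rewrite (pE _ mUF).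
  under eq_fun do under eq_bigr do rewrite (pE _ (mF _)).
  exact: mu_sigma_additive.
pose mp := isMeasure.Build _ _ _ p p0 pge0 psum.
pose m : {measure set (algebra_at x G0 GU GC) -> \bar R} := HB.pack p mp.
have mE A : G A -> measure_extension m A = mu A.
  by move=> GA; rewrite -pE//; exact: (measurable_mu_extE m).
exists (measure_extension m); split=> //; split.
- exact: measure0.
- by move=> A _; exact: measure_ge0.
- move=> F bF tF; rewrite bG in bF; apply: measure_semi_sigma_additive => //.
  exact: sigma_algebra_bigcup.
- by rewrite mE.
Qed.

End extension.

(** Compactness gives a cluster point, and a cluster point of the image of an ultrafilter is a
    limit. *)
Lemma ultra_fmap_compact (S T : topologicalType) (g : S -> T)
    (F : set_system S) (K : set T) : UltraFilter F -> compact K ->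
  F (g @^-1` K) -> exists2 p, K p & g @ F --> p.
Proof.
move=> FU cK FK; have [p [Kp gFp]] := cK (g @ F) _ FK.
exists p => // V pV; have [//|FnV] := in_ultra_setVsetC (g @^-1` V) FU.
by have [y [nVy Vy]] := gFp (~` V) V FnV pV.
Qed.

(** * The projective limit and its cylinders *)

Section projective_limit.
Context (Y : nat -> topologicalType) (f : forall m n : nat, Y n -> Y m).
Arguments f : clear implicits.
Hypothesis fcont : forall m n, (m <= n)%N -> continuous (f m n).
Hypothesis fsurj : forall m n, (m <= n)%N -> forall y, exists x, f m n x = y.
Hypothesis fcomp : forall m n p, (m <= n <= p)%N -> f m p = f m n \o f n p.
Hypothesis fid : forall n, f n n = id.

Lemma fbar_comp m n : (m <= n)%N -> fbar f m = f m n \o fbar f n.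
Proof. by move=> mn; apply/funext => y; apply: (set_valP y). Qed.

Lemma fbar_continuous n : continuous (fbar f n).
Proof.
move=> y; apply: (@continuous_comp _ _ _ (@set_val _ (projlim_set f)) (@proj _ Y n)).
  exact: initial_continuous.
exact: proj_continuous.
Qed.

(** Project [y] down to the levels below [n] and lift it step by step above. Surjectivity makes the
    base of a cylinder at a given level unique. *)
Lemma fbar_surjective n (y : Y n) : exists x, fbar f n x = y.
Proof.
pose h k (x : Y k) := projT1 (cid (fsurj (leqnSn k) x)).
have hK k (x : Y k) : f k k.+1 (h k x) = x by rewrite /h; case: cid.
pose z := fix z k : Y k := if k is j.+1
  then (if (j.+1 <= n)%N then f j.+1 n y else h j (z j))
  else f 0%N n y.
have zn k : (k <= n)%N -> z k = f k n y by case: k => //= k ->.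
have zS k : z k = f k k.+1 (z k.+1).
  rewrite [z k.+1]/=; case: ifP => [kn|_]; last by rewrite hK.
  by rewrite zn 1?ltnW// (@fcomp k k.+1 n)// leqnSn.
have zP : projlim_set f z.
  move=> j k; elim: k => [|k IH]; first by rewrite leqn0 => /eqP ->; rewrite fid.
  rewrite leq_eqVlt => /orP[/eqP->|]; first by rewrite fid.
  by rewrite ltnS => jk; rewrite (@fcomp j k k.+1) ?jk ?leqnSn//= -zS; exact: IH.
by exists (exist _ z (mem_set zP)); rewrite /fbar set_valE /= zn// fid.
Qed.

Lemma fbar_preimage_subset n (E E' : set (Y n)) :
  fbar f n @^-1` E `<=` fbar f n @^-1` E' -> E `<=` E'.
Proof. by move=> EE' y; have [x <-] := fbar_surjective y => /EE'. Qed.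

Lemma fbar_preimage_inj n (E E' : set (Y n)) :
  fbar f n @^-1` E = fbar f n @^-1` E' -> E = E'.
Proof. by move=> EE'; apply/seteqP; split; apply: fbar_preimage_subset; rewrite EE'. Qed.

Definition borel_cylinder : set (set (projlim f)) :=
  [set A | exists n (E : set (Y n)), borel E /\ A = fbar f n @^-1` E].

Lemma borel_cylinder_level A : borel_cylinder A ->
  exists n, forall p, (n <= p)%N ->
    exists E : set (Y p), borel E /\ A = fbar f p @^-1` E.
Proof.
move=> [n [E [bE ->]]]; exists n => p np; exists (f n p @^-1` E).
by split; [exact: borel_preimage (fcont np) bE|rewrite (fbar_comp np)].
Qed.

(** Reduces finite operations on cylinders to operations on bases in one space. *)
Lemma borel_cylinder_level2 A A' : borel_cylinder A -> borel_cylinder A' ->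
  exists n (E E' : set (Y n)),
  [/\ borel E, borel E', A = fbar f n @^-1` E & A' = fbar f n @^-1` E'].
Proof.
move=> /borel_cylinder_level[n nA] /borel_cylinder_level[n' nA'].
have [E [bE AE]] := nA _ (leq_maxl n n').
have [E' [bE' AE']] := nA' _ (leq_maxr n n').
by exists (maxn n n'), E, E'.
Qed.

Lemma borel_cylinderT : borel_cylinder setT.
Proof. by exists 0%N, setT; split => //; exact: borelT. Qed.

Lemma borel_cylinder0 : borel_cylinder set0.
Proof. by exists 0%N, set0; split => //; exact: borel0. Qed.

Lemma borel_cylinderC : setC_closed borel_cylinder.
Proof. by move=> _ [n [E [bE ->]]]; exists n, (~` E); split => //; exact: borelC. Qed.

Lemma borel_cylinderU : setU_closed borel_cylinder.
Proof.
move=> A A' cA /(borel_cylinder_level2 cA)[n [E [E' [bE bE' -> ->]]]].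
by exists n, (E `|` E'); split => //; exact: borelU.
Qed.

Lemma borel_cylinderI : setI_closed borel_cylinder.
Proof.
move=> A A' cA /(borel_cylinder_level2 cA)[n [E [E' [bE bE' -> ->]]]].
by exists n, (E `&` E'); split => //; exact: borelI.
Qed.

Lemma borel_cylinderD : setD_closed borel_cylinder.
Proof.
move=> A A' cA cA'; rewrite setDE; apply: borel_cylinderI => //.
exact: borel_cylinderC.
Qed.

Lemma projlim_nbhs (x : projlim f) (A : set (projlim f)) : nbhs x A ->
  exists n (U : set (Y n)),
    [/\ open U, U (fbar f n x) & fbar f n @^-1` U `<=` A].
Proof.
pose F : set_system (projlim f) := [set A | exists n (U : set (Y n)),
    [/\ open U, U (fbar f n x) & fbar f n @^-1` U `<=` A]].
have FF : Filter F.
  split.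
  - by exists 0%N, setT; split => //; exact: openT.
  - have lift m n (U : set (Y m)) : (m <= n)%N -> open U -> U (fbar f m x) ->
        open (f m n @^-1` U) /\ (f m n @^-1` U) (fbar f n x).
      move=> mn oU Ux; split; first by move/continuousP: (fcont mn); exact.
      by move: Ux; rewrite (fbar_comp mn).
    move=> P Q [m [U [oU Ux UP]]] [n [V [oV Vx VQ]]].
    have [oU' Ux'] := lift _ _ _ (leq_maxl m n) oU Ux.
    have [oV' Vx'] := lift _ _ _ (leq_maxr m n) oV Vx.
    exists (maxn m n), (f m (maxn m n) @^-1` U `&` f n (maxn m n) @^-1` V).
    split; [exact: openI|by []|move=> y [Uy Vy]; split].
      by apply: UP; rewrite (fbar_comp (leq_maxl m n)).
    by apply: VQ; rewrite (fbar_comp (leq_maxr m n)).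
  - move=> P Q PQ [n [U [oU Ux UP]]]; exists n, U; split => //.
    exact: subset_trans PQ.
(* Convergence in the product topology may be checked one coordinate at a time, where it is
   immediate from the definition of [F]. *)
suff Fx : @set_val _ (projlim_set f) @ F --> (set_val x : prod_topology Y).
  rewrite nbhsE => -[_ [[W oW <-] Wx] WA].
  have /Fx [n [U [oU Ux UW]]] : nbhs (set_val x : prod_topology Y) W.
    exact: open_nbhs_nbhs.
  by exists n, U; split => //; exact: subset_trans WA.
apply/cvg_sup => n B; rewrite nbhsE => -[_ [[U oU <-] Ux] UB].
by exists n, U; split => // y Uy; exact: UB.
Qed.

(* Levelwise, the union [U n] of all open sets whose preimage lies in a given
   open set [O] is again open, so [O] is a countable union of cylinders without
   any second countability assumption. *)
Lemma borel_projlimE : @borel (projlim f) = <<s borel_cylinder >>.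
Proof.
apply/seteqP; split; apply: smallest_sub; try exact: smallest_sigma_algebra.
  move=> O oO; pose U n := \bigcup_(V in [set V : set (Y n) |
    open V /\ fbar f n @^-1` V `<=` O]) V.
  have -> : O = \bigcup_n (fbar f n @^-1` U n).
    apply/seteqP; split=> [x Ox|x [n _ [V [_ VO] Vx]]]; last exact: VO.
    have [n [V [oV Vx VO]]] := projlim_nbhs (open_nbhs_nbhs (conj oO Ox)).
    by exists n => //; exists V.
  apply: sigma_algebra_bigcup => n; apply: sub_sigma_algebra.
  exists n, (U n); split => //; apply: borel_open; apply: bigcup_open.
  by move=> V [].
move=> _ [n [E [bE ->]]]; apply: borel_preimage bE; exact: fbar_continuous.
Qed.

(** * The cylinder content and its continuity at the empty set *)

Section compatible_probabilities.
Context (R : realType) (mu : forall n, set (Y n) -> \bar R).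
Arguments mu n _ : clear implicits.
Hypothesis Yhausdorff : forall n, hausdorff_space (Y n).
Hypothesis mu_prob : forall n, borel_probability (mu n).
Hypothesis mu_compat : forall m n, (m <= n)%N -> forall E, borel E ->
  mu m E = mu n (f m n @^-1` E).
Hypothesis mu_regular : forall n (A : set (Y n)), borel A ->
  forall e : R, 0 < e ->
  exists K, [/\ compact K, K `<=` A & (mu n (A `\` K) < e%:E)%E].

Lemma cylinder_content_exists : exists c : set (projlim f) -> \bar R,
  forall n (E : set (Y n)), borel E -> c (fbar f n @^-1` E) = mu n E.
Proof.
(* Independence of the representation: pull the lower base up to the higher level, where equal
   cylinders have equal bases. *)
have wd n m (E : set (Y n)) (E' : set (Y m)) : borel E -> borel E' ->
    fbar f n @^-1` E = fbar f m @^-1` E' -> mu n E = mu m E'.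
  wlog nm : n m E E' / (n <= m)%N.
    move=> W bE bE' EE'; have [nm|/ltnW mn] := leqP n m; first exact: W.
    by apply/esym/W.
  move=> bE bE'; rewrite (fbar_comp nm) comp_preimage.
  by move/fbar_preimage_inj => <-; exact: mu_compat.
exists (fun A => xget 0%E [set v | exists n (E : set (Y n)),
  [/\ borel E, A = fbar f n @^-1` E & v = mu n E]]) => n E bE.
case: xgetP => [_ _ [m [E' [bE' EE' ->]]]|/(_ (mu n E))[]]; first exact: wd.
by exists n, E.
Qed.

Section cylinder_content.
Context (c : set (projlim f) -> \bar R).
Hypothesis cE : forall n (E : set (Y n)), borel E -> c (fbar f n @^-1` E) = mu n E.

Lemma cylinder_content_ge0 A : borel_cylinder A -> (0 <= c A)%E.
Proof. by move=> [n [E [bE ->]]]; rewrite cE//; exact: bprob_ge0. Qed.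

Lemma cylinder_content_le A B : borel_cylinder A -> borel_cylinder B ->
  A `<=` B -> (c A <= c B)%E.
Proof.
move=> cA /(borel_cylinder_level2 cA)[n [E [E' [bE bE' -> ->]]]].
move=> /fbar_preimage_subset EE'.
by rewrite !cE//; exact: bprob_le.
Qed.

Lemma cylinder_contentU A B : borel_cylinder A -> borel_cylinder B ->
  A `&` B = set0 -> c (A `|` B) = (c A + c B)%E.
Proof.
move=> cA /(borel_cylinder_level2 cA)[n [E [E' [bE bE' -> ->]]]].
rewrite -preimage_setI -(preimage_set0 (fbar f n)).
move=> /fbar_preimage_inj EE'.
have bU := borelU bE bE'.
rewrite -preimage_setU !cE// (bprobID (mu_prob n) bU bE) addeC setUK setDUl setDv.
by rewrite set0U setDidl// setIC.
Qed.

Lemma cylinder_content_subadditive A B : borel_cylinder A -> borel_cylinder B ->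
  (c (A `|` B) <= c A + c B)%E.
Proof.
move=> cA /(borel_cylinder_level2 cA)[n [E [E' [bE bE' -> ->]]]].
by rewrite -preimage_setU !cE//; [exact: bprobU2|exact: borelU].
Qed.

(** A level of at least [i] lets the compact set found for the i-th cylinder control coordinate [i]
    of the limit point. Level and base are packed in one pair for the later use of choice. *)
Lemma cylinder_content_inner A : borel_cylinder A -> forall i (e : R), 0 < e ->
  exists nK : {n & set (Y n)}, [/\ (i <= tag nK)%N, compact (tagged nK),
    fbar f (tag nK) @^-1` tagged nK `<=` A &
    (c (A `\` fbar f (tag nK) @^-1` tagged nK) < e%:E)%E].
Proof.
move=> /borel_cylinder_level[n nA] i e e0.
have [E [bE ->]] := nA _ (leq_maxl n i).
have [K [cK KE mK]] := mu_regular bE e0.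
exists (existT _ (maxn n i) K) => /=; split => //; first exact: leq_maxr.
  by move=> x /KE.
have bK : borel K by apply: borel_closed; apply: compact_closed.
by rewrite -[_ `\` _]/(fbar f _ @^-1` (E `\` K)) cE//; exact: borelD.
Qed.

Lemma cylinder_content_cont0 (F : (set (projlim f))^nat) (e : R) : 0 < e ->
  (forall i, borel_cylinder (F i)) -> nonincreasing_seq F ->
  \bigcap_i F i = set0 -> exists n, (c (F n) < e%:E)%E.
Proof.
move=> e0 cF niF F0; apply: contrapT => /forallNP Fe.
have e2 i : 0 < e / (2 ^ i.+1)%:R by rewrite divr_gt0// ltr0n expn_gt0.
have /choice[K HK] := fun i => cylinder_content_inner (cF i) i (e2 i).
pose C i := fbar f (tag (K i)) @^-1` tagged (K i).
have cC i : borel_cylinder (C i).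
  have [_ cK _ _] := HK i; exists (tag (K i)), (tagged (K i)); split => //.
  by apply: borel_closed; apply: compact_closed.
pose D := fix D i := if i is j.+1 then D j `&` C j.+1 else C 0%N.
have cD i : borel_cylinder (D i) by elim: i => //= i IH; exact: borel_cylinderI.
have DC i k : (i <= k)%N -> D k `<=` C i.
  elim: k => [|k IH]; first by rewrite leqn0 => /eqP ->.
  by rewrite leq_eqVlt => /orP[/eqP-> x []//|/IH DC]; apply: subset_trans DC => x [].
(* The losses e/2 + ... + e/2^(k+1) add up to e - e/2^(k+1); this is below [e], so [D k] cannot be
   empty. *)
have cFD k : (c (F k `\` D k) < (e - e / (2 ^ k.+1)%:R)%:E)%E.
  elim: k => [|k IH].
    have [_ _ _] := HK 0%N; rewrite [in X in _ -> X](_ : e - _ = e / (2 ^ 1)%:R)//.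
    by rewrite expn1; lra.
  apply: (@le_lt_trans _ _ (c ((F k `\` D k) `|` (F k.+1 `\` C k.+1)))).
    apply: cylinder_content_le.
    - exact: borel_cylinderD.
    - by apply: borel_cylinderU => //; exact: borel_cylinderD.
    - move=> x [Fx /not_andP[nD|nC]]; last by right.
      by left; split => //; move: x Fx {nD}; apply/subsetPset/niF.
  apply: le_lt_trans (cylinder_content_subadditive _ _) _.
  - exact: borel_cylinderD.
  - exact: borel_cylinderD.
  rewrite [X in X%:E](_ : _ = (e - e / (2 ^ k.+1)%:R) + e / (2 ^ k.+2)%:R).
    by rewrite EFinD; apply: lteD => //; have [] := HK k.+1.
  by rewrite [(2 ^ k.+2)%N]expnS natrM invfM; lra.
have /choice[y Dy] k : exists y, D k y.
  apply/set0P/eqP => Dk0; apply: (Fe k).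
  by have := cFD k; rewrite Dk0 setD0 => /lt_le_trans; apply; rewrite lee_fin gerBl ltW.
(* The ultrafilter contains every tail of [y], hence every [C i]; it replaces a diagonal extraction
   of subsequences. *)
have [G [GU yG]] := ultraFilterLemma (fmap_proper_filter y eventually_filter).
have GC i : G (C i).
  by apply: yG; exists i => // k /= ik; exact: DC (Dy k).
have ex_lim j : exists p : Y j, fbar f j @ G --> p.
  have [jn cK _ _] := HK j.
  (* The image in [Y j] of the j-th compact set is compact and contains coordinate [j] of every
     point of [C j]. *)
  have [||p _ ?] := @ultra_fmap_compact _ _ (fbar f j) G
      (f j (tag (K j)) @` tagged (K j)) GU; last by exists p.
    by apply: continuous_compact => //; apply: continuous_subspaceT; exact: fcont.
  apply: filterS (GC j) => x Cx; exists (fbar f (tag (K j)) x) => //.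
  by rewrite (fbar_comp jn).
pose p j := projT1 (cid (ex_lim j)).
have Gp j : fbar f j @ G --> p j := projT2 (cid (ex_lim j)).
have pP : projlim_set f p.
  move=> i j ij; apply: (cvg_unique _ (Gp i)); first exact: Yhausdorff.
  rewrite (fbar_comp ij); apply: cvg_comp (Gp j) _; exact: fcont.
suff : (\bigcap_i F i) (exist _ p (mem_set pP)) by rewrite F0.
move=> i _; have [_ cK CF _] := HK i; apply: CF.
(* The ultrafilter also converges inside the i-th compact set; limits being unique, that limit is
   the coordinate of [p]. *)
have [q Kq Gq] := ultra_fmap_compact GU cK (GC i).
rewrite /= /fbar set_valE /=; suff <- : q = p (tag (K i)) by [].
by apply: (cvg_unique _ Gq (Gp _)); exact: Yhausdorff.
Qed.

End cylinder_content.

Theorem projlim_probability : exists P : set (projlim f) -> \bar R,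
  borel_probability P /\
  forall n E, borel E -> P (fbar f n @^-1` E) = mu n E.
Proof.
have [c cE] := cylinder_content_exists.
have [y _] := borel_probability_inhabited (mu_prob 0).
(* The extension is stated over a given point of the space. *)
have [x _] := fbar_surjective y.
have cT : c setT = 1%E.
  by rewrite -(preimage_setT (fbar f 0)) cE; [have [] := mu_prob 0|exact: borelT].
have [P [hP Pc]] := bprob_extension borel_cylinder0 borel_cylinderU
  borel_cylinderC borel_projlimE cT (cylinder_content_ge0 cE)
  (cylinder_contentU cE) (cylinder_content_cont0 cE) x.
exists P; split => // n E bE; rewrite -cE// Pc//.
by exists n, E.
Qed.

End compatible_probabilities.

End projective_limit.

(** * Existence and uniqueness of the limit system *)

Unset Implicit Arguments.

Theorem theoremB1 (R : realType) (Y : nat -> metricType R)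
  (f : forall m n : nat, Y n -> Y m) (B : forall n, set (set (Y n)))
  (mu : forall n, set (Y n) -> set (Y n) -> \bar R) :
  projective_sequence_CPS f B mu ->
  (forall n, souslin R (Y n)) ->
  [/\ (forall n, projlim_family f B = preimage_family (fbar f n) (B n)),
      (exists muY, limit_CPS f B mu muY)
    & (forall mu1 mu2, limit_CPS f B mu mu1 -> limit_CPS f B mu mu2 ->
         forall A C, borel A -> projlim_family f B C -> mu1 A C = mu2 A C)].
Proof.
move=> [[Yhausdorff _ fcs] [fcomp fid] [Bcond BE] muCPS mu_compat] Ysouslin.
have fcont m n (mn : (m <= n)%N) := (fcs m n mn).1.
have fsurj m n (mn : (m <= n)%N) := (fcs m n mn).2.
have fbarP n C : fbar f n @^-1` (f 0 n @^-1` C) = fbar f 0 @^-1` C.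
  by rewrite -comp_preimage -(fbar_comp f).
have Bpre n C : B 0 C -> B n (f 0 n @^-1` C).
  by move=> BC; rewrite (BE 0 n)//; exists C.
have B0bor C : B 0 C -> borel C by have [_ _ +] := Bcond 0; exact.
have famE n : projlim_family f B = preimage_family (fbar f n) (B n).
  rewrite (BE 0 n)//; apply/seteqP; split=> [_ [C BC <-]|_ [_ [C BC <-] <-]].
    by exists (f 0 n @^-1` C) => //; exists C.
  by rewrite fbarP; exists C.
have bT := @borel_cylinderT _ f.
have bI := borel_cylinderI fcont.
have bG := borel_projlimE fcont.
split=> //; last first.
  move=> mu1 mu2 [[p1 _ _] lim1] [[p2 _ _] lim2] A _ bA [C BC <-].
  have DC : projlim_family f B (fbar f 0 @^-1` C) by exists C.
  apply: (bprob_eq (p1 _ DC) (p2 _ DC) bG bI bT) => // _ [n [E [bE ->]]].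
  rewrite -(fbarP n).
  have := lim2 n E _ bE (Bpre n C BC); rewrite /image_CPS => ->.
  exact: lim1 (Bpre n C BC).
(* Choice ranges over all sets [D]; those that are not conditioning events receive the zero
   function. *)
have /choice[mY mYP] : forall D : set (projlim f),
    exists P : set (projlim f) -> \bar R, forall C, B 0 C ->
    D = fbar f 0 @^-1` C -> borel_probability P /\
    forall n E, borel E -> P (fbar f n @^-1` E) = mu n E (f 0 n @^-1` C).
  move=> D; have [[C BC DC]|nD] := pselect (projlim_family f B D); last first.
    by exists (fun=> 0%E) => C BC DC; exfalso; apply: nD; exists C.
  have mup n : borel_probability (fun E => mu n E (f 0 n @^-1` C)).
    by have [+ _ _] := muCPS n; apply; exact: Bpre.
  have [||||P [hP PE]] := projlim_probability fcont fsurj fcomp fid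
      (mu := fun n E => mu n E (f 0 n @^-1` C)).
  - exact: Yhausdorff.
  - exact: mup.
  - move=> m n mn E bE; rewrite (mu_compat m n)//; last exact: Bpre.
    by rewrite /image_CPS (fcomp 0 m n).
  - by move=> n A bA e e0; exact: (souslin_compact_regular (mup n)).
  exists P => C' BC' DC'.
  (* Surjectivity of the projection makes [C] depend on [D] alone. *)
  suff <- : C = C' by [].
  by apply: (fbar_preimage_inj fsurj fcomp fid); rewrite DC.
exists (fun A D => mY D A).
have mYprob C : B 0 C -> borel_probability (mY (fbar f 0 @^-1` C)).
  by move=> BC; have [] := mYP _ C BC erefl.
have mYE C n E : B 0 C -> borel E ->
    mY (fbar f 0 @^-1` C) (fbar f n @^-1` E) = mu n E (f 0 n @^-1` C).
  by move=> BC; have [_ +] := mYP _ C BC erefl; exact.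
split; first split.
- by move=> _ [C BC <-]; exact: mYprob.
- move=> _ [C BC <-]; rewrite mYE//; last exact: B0bor.
  by rewrite fid; have [_ + _] := muCPS 0; exact.
- move=> A _ _ bA [b Bb <-] [C BC <-] Ab bC.
  have bC' : b `<=` C by exact: (fbar_preimage_subset fsurj fcomp fid bC).
  have bb := B0bor b Bb.
  have bD : borel (fbar f 0 @^-1` b).
    by apply: borel_preimage bb; exact: fbar_continuous.
  have kfin := bprob_fin (mYprob C BC) bD.
  have k0 := bprob_ge0 (mYprob C BC) bD.
  (* With k the limit probability of b given C, the chain rule need only be checked on traces of
     cylinders on b, where it is the chain rule of [mu n]. *)
  have /(_ _ A bA) := bprob_scale_trace_eq (fine_ge0 k0) (mYprob b Bb) (mYprob C BC)
    bD bG bI bT.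
  rewrite fineK// (setIidl Ab) muleC; apply => _ [n [E [bE ->]]].
  have bbn : borel (f 0 n @^-1` b) by apply: borel_preimage bb; exact: fcont.
  have bEb := borelI bE bbn.
  have -> : fbar f n @^-1` E `&` fbar f 0 @^-1` b =
      fbar f n @^-1` (E `&` f 0 n @^-1` b) by rewrite preimage_setI fbarP.
  have -> : mY (fbar f 0 @^-1` C) (fbar f 0 @^-1` b) =
      mu n (f 0 n @^-1` b) (f 0 n @^-1` C) by rewrite -(fbarP n b) mYE.
  rewrite muleC !mYE//.
  have [_ _ chain] := muCPS n.
  by apply: chain => //; [exact: Bpre|exact: Bpre|move=> x /bC'].
- move=> n E C bE; rewrite (BE 0 n)// => -[C0 BC0 <-].
  by rewrite /image_CPS fbarP mYE.
Qed.
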